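(* Let $q\ge5$ be a prime power and let $\mathcal{B}$ be a minimal blocking set in $\mathrm{PG}(2,q)$ built with a $k$-construction with $2q\le k\le 3q-5$ (notation as in the context, so $k=3q-3-n$). Then $\mathcal{B}$ has the $r_\infty$-property with respect to every point $$P\in\mathcal{B}\cap\Big(\big(a\setminus \textstyle\bigcup_{i,j=1}^{n}\{B_iC_j\cap a\}\big)\cup b\cup c\Big).$$
   Context: A blocking set of $\mathrm{PG}(2,q)$ is a set of points meeting every line and containing no line; minimal if no proper subset is a blocking set. A line is tangent to a point set $\mathcal{K}$ if it meets $\mathcal{K}$ in exactly one point, secant if in more than one. $\mathcal{B}$ has the $r_\infty$-property with respect to $P\in\mathcal{B}$ if exactly one line through $P$ is tangent to $\mathcal{B}$ and all other lines through $P$ are secants. $k$-construction (for $q\ge4$): let $a,b,c$ be non-concurrent lines, $C=a\cap b$, $B=a\cap c$, $A=b\cap c$, and let $\mathcal{T}$ be the vertexless triangle (points on exactly one of $a,b,c$). Choose a line $\ell$ through $A$ different from $b,c$, put $A'=\ell\cap a$, and choose $D_1\in\ell\setminus\{A,A'\}$. Put $B_1=BD_1\cap b$. If $q$ is odd, let $D_2=CC_2\cap\ell$ where $C_2=A'B_1\cap c$; if $q$ is even, choose $D_2\in\ell\setminus\{A,A',D_1\}$. Choose further distinct points $D_3,\dots,D_n\in\ell\setminus\{A,A'\}$ different from $D_1,D_2$, with $2\le n\le q-2$. For each $i$ let $B_i=BD_i\cap b$, $C_i=CD_i\cap c$. Then $\mathcal{B}=(\mathcal{T}\cup\{D_1,\dots,D_n\})\setminus\{B_1,\dots,B_n,C_1,\dots,C_n\}$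 is a minimal blocking set of size $k=3q-3-n$, said to be built with a $k$-construction. $B_iC_j$ denotes the line through $B_i$ and $C_j$. *)

(* Defs.v *)
From HB Require Import structures.
From mathcomp Require Import all_boot all_order all_algebra.

Set Implicit Arguments.
Unset Strict Implicit.
Unset Printing Implicit Defensive.

(* For the subtype projection vs2mx of {vspace vT}. *)
Import VectorInternalTheory.

HB.instance Definition _ (F : finFieldType) (vT : vectType F) :=
  [Countable of {vspace vT} by <:].
HB.instance Definition _ (F : finFieldType) (vT : vectType F) :=
  [Finite of {vspace vT} by <:].

(* PG(2, q), q = #|F|: points and lines are the subspaces of F^3 of dimension
   1 and 2, and incidence is inclusion.  Hence (P + Q)%VS is the line joining
   two distinct points, and (l :&: m)%VS the common point of two distinct
   lines. *)
Notation pg F := {vspace 'rV[F]_3}.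

Definition points (F : finFieldType) : {set pg F} := [set P | \dim P == 1].
Definition lines (F : finFieldType) : {set pg F} := [set l | \dim l == 2].

Definition line_points (F : finFieldType) (l : pg F) : {set pg F} :=
  [set P in points F | (P <= l)%VS].

Definition blocking_set (F : finFieldType) (K : {set pg F}) : bool :=
  [&& K \subset points F,
      [forall l in lines F, K :&: line_points l != set0]
    & [forall l in lines F, ~~ (line_points l \subset K)]].

Definition minimal_blocking_set (F : finFieldType) (K : {set pg F}) : bool :=
  minset (@blocking_set F) K.

Definition tangent (F : finFieldType) (l : pg F) (K : {set pg F}) : bool :=
  (l \in lines F) && (#|K :&: line_points l| == 1).

Definition secant (F : finFieldType) (l : pg F) (K : {set pg F}) : bool :=
  (l \in lines F) && (1 < #|K :&: line_points l|).

Definition r_infty_property (F : finFieldType) (K : {set pg F}) (P : pg F) :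
    Prop :=
  P \in K /\
  exists t : pg F,
    [/\ (P <= t)%VS, tangent t K
      & forall m : pg F, m \in lines F -> (P <= m)%VS -> m != t -> secant m K].

Definition vertexless_triangle (F : finFieldType) (a b c : pg F) :
    {set pg F} :=
  [set P in points F | (P <= a)%VS + (P <= b)%VS + (P <= c)%VS == 1].

(* B_i = B D_i /\ b and C_i = C D_i /\ c, where B = a /\ c and C = a /\ b. *)
Definition kB (F : finFieldType) (a b c : pg F) (D : nat -> pg F) (i : nat) :
    pg F :=
  (((a :&: c) + D i) :&: b)%VS.
Definition kC (F : finFieldType) (a b c : pg F) (D : nat -> pg F) (i : nat) :
    pg F :=
  (((a :&: b) + D i) :&: c)%VS.

(* The points D_1, ..., D_n are D 1, ..., D n; the other values of D are
   irrelevant, and families indexed by 1, ..., n are written with i.+1 for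
   i : 'I_n. *)
Definition k_construction_set (F : finFieldType) (a b c : pg F) (n : nat)
    (D : nat -> pg F) : {set pg F} :=
  (vertexless_triangle a b c :|: [set D i.+1 | i : 'I_n]) :\:
  ([set kB a b c D i.+1 | i : 'I_n] :|: [set kC a b c D i.+1 | i : 'I_n]).

Record k_construction (F : finFieldType) (k : nat) (a b c l : pg F) (n : nat)
    (D : nat -> pg F) (K : {set pg F}) : Prop := KConstruction {
  kc_q : 4 <= #|F|;
  kc_lines : [/\ a \in lines F, b \in lines F & c \in lines F];
  kc_nonconcurrent :
    ~ exists2 P : pg F, P \in points F & [&& P <= a, P <= b & P <= c]%VS;
  kc_l : l \in lines F;
  kc_l_A : (b :&: c <= l)%VS;
  kc_l_neq : l != b /\ l != c;
  kc_n : 2 <= n <= #|F| - 2;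
  kc_D : forall i : nat, 1 <= i <= n ->
    D i \in line_points l :\: [set (b :&: c)%VS; (l :&: a)%VS];
  kc_D_inj : {in [pred i | 1 <= i <= n] &, injective D};
  (* D_2 = C C_2 /\ l with C_2 = A' B_1 /\ c and A' = l /\ a *)
  kc_D2_odd : odd #|F| ->
    let C2 := (((l :&: a) + kB a b c D 1) :&: c)%VS in
    D 2 = (((a :&: b) + C2) :&: l)%VS;
  kc_K : K = k_construction_set a b c n D;
  kc_k : k = 3 * #|F| - 3 - n
}.

(* Main.v *)
Require Import Defs.
From mathcomp Require Import all_boot all_order all_algebra.
From mathcomp Require Import all_fingroup all_solvable zify.

Import GRing.Theory FinRing.Theory.

(* Let A = b /\ c, B = a /\ c, C = a /\ b.  The tangent at a point P of K on b
   is BP: it meets a and c in the vertex B only, and it contains some D_i only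
   if P = B_i.  Any other line through P except b meets a in a non-vertex, and
   all of these belong to K; b itself keeps at least q - 1 - n >= 2 points.
   The lines b and c play symmetric roles.  For P on a, the tangent is AP,
   provided that P is not the point A' of l on a.  Any other line m <> a through
   P meets b and c in distinct non-vertices; if neither lies in K they are some
   B_i and C_j, so that P is on B_iC_j.  Finally A' is excluded by the
   hypothesis on P: for q odd the choice of D_2 puts A' on B_1C_2, and for q
   even A' is on B_1C_1 because A', B_1, C_1 are the diagonal points of the
   quadrangle A, B, C, D_1. *)

(** * Incidence in the projective plane, through dimensions of subspaces *)

Section Plane.
Context {F : finFieldType}.
Implicit Types P Q l m : pg F.

Lemma point_eq P Q : \dim P = 1 -> \dim Q = 1 -> (P <= Q)%VS -> P = Q.
Proof. by move=> dP dQ sPQ; apply/eqP; rewrite eqEdim sPQ dP dQ. Qed.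

Lemma line_eq l m : \dim l = 2 -> \dim m = 2 -> (l <= m)%VS -> l = m.
Proof. by move=> dl dm slm; apply/eqP; rewrite eqEdim slm dl dm. Qed.

Lemma dim_join P Q : \dim P = 1 -> \dim Q = 1 -> P <> Q -> \dim (P + Q) = 2.
Proof.
move=> dP dQ nPQ; have := dimv_sum_cap P Q; rewrite dP dQ.
have := dimvS (capvSl P Q); rewrite dP.
case E: (\dim (P :&: Q)) => [|[|//]] _; first by rewrite addn0.
by case: nPQ; rewrite -(point_eq (P :&: Q) P) ?capvSl //; apply: point_eq; rewrite ?capvSr.
Qed.

(** By the dimension formula, two planes of a 3-dimensional space cannot meet trivially; a meet of
    dimension 2 would equal both. *)
Lemma dim_meet l m : \dim l = 2 -> \dim m = 2 -> l <> m -> \dim (l :&: m) = 1.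
Proof.
move=> dl dm nlm; have := dimv_sum_cap l m; rewrite dl dm.
have : \dim (l + m) <= 3 by rewrite (leq_trans (dimvS (subvf _))) ?dimvf ?dim_matrix.
have := dimvS (capvSl l m); rewrite dl.
case E: (\dim (l :&: m)) => [|[|[|//]]] _ //; first by rewrite addn0 => /[swap] ->.
by case: nlm; rewrite -(line_eq (l :&: m) l) ?capvSl //; apply: line_eq; rewrite ?capvSr.
Qed.

Lemma join_eq P Q l : \dim P = 1 -> \dim Q = 1 -> \dim l = 2 -> P <> Q ->
  (P <= l)%VS -> (Q <= l)%VS -> (P + Q)%VS = l.
Proof.
by move=> dP dQ dl nPQ sP sQ; apply: line_eq; rewrite ?dim_join // subv_add sP.
Qed.

Lemma lines_eq P Q l m : \dim P = 1 -> \dim Q = 1 -> \dim l = 2 ->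
  \dim m = 2 -> P <> Q ->
  (P <= l)%VS -> (Q <= l)%VS -> (P <= m)%VS -> (Q <= m)%VS -> l = m.
Proof.
by move=> dP dQ dl dm nPQ *; rewrite -(join_eq P Q l) // (join_eq P Q m).
Qed.

Lemma meet_eq P l m : \dim P = 1 -> \dim l = 2 -> \dim m = 2 -> l <> m ->
  (P <= l)%VS -> (P <= m)%VS -> (l :&: m)%VS = P.
Proof.
move=> dP dl dm nlm sl sm; apply/esym/point_eq; rewrite ?dim_meet //.
by rewrite subv_cap sl.
Qed.

Lemma in_line_points P l : (P \in line_points l) = (\dim P == 1) && (P <= l)%VS.
Proof. by rewrite !inE. Qed.

Lemma point_vline P v : \dim P = 1 -> v \in P -> v != 0%R -> P = <[v]>%VS.
Proof.
by move=> dP vP v0; apply/esym/point_eq; rewrite // dim_vline v0.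
Qed.

(** If u and v span [l], then <u> and the <v + t u>, for t in F, are q + 1 distinct points of it. *)
Lemma card_line_points l : \dim l = 2 -> #|F| < #|line_points l|.
Proof.
move=> dl.
have l0 : (l != 0)%VS by rewrite -dimv_eq0 dl.
pose u := vpick l; have ul : u \in l by apply: memv_pick.
have u0 : u != 0%R by rewrite vpick0.
have /subvPn [v vl nv] : ~~ (l <= <[u]>)%VS.
  by apply/negP => /dimvS; rewrite dl dim_vline u0.
pose p (t : F) := <[v + t *: u]>%VS.
have pu t : <[u]>%VS != p t.
  apply: contra nv => /eqP E; have : (v + t *: u)%R \in <[u]>%VS by rewrite E memv_line.
  by rewrite rpredDr // rpredZ // memv_line.
have p0 t : (v + t *: u != 0)%R.
  apply: contra nv; rewrite addr_eq0 => /eqP ->.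
  by rewrite rpredN rpredZ // memv_line.
have pinj : injective p.
  move=> s t E; have : (v + s *: u)%R \in p t by rewrite -E memv_line.
  (* From v + s u = x (v + t u) one gets (1 - x) v + (s - x t) u = 0: either x = 1 and s = t, or v
     is a multiple of u. *)
  case/vlineP => x /eqP; rewrite scalerDr -subr_eq0 opprD addrACA -{1}[v]scale1r.
  rewrite -scalerBl scalerA -scalerBl => /eqP H.
  case: (eqVneq (1 - x)%R 0%R) => [/eqP|x1].
    rewrite subr_eq0 => /eqP x1; move: H; rewrite -x1 subrr scale0r add0r mul1r.
    by move/eqP; rewrite scaler_eq0 (negbTE u0) orbF subr_eq0 => /eqP.
  case/negP: nv; rewrite -[v]scale1r -(mulVf x1) -scalerA rpredZ //.
  by move/eqP: H; rewrite addr_eq0 => /eqP ->; rewrite rpredN rpredZ ?memv_line.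
have <- : #|<[u]>%VS |: [set p t | t : F]| = #|F|.+1.
  rewrite cardsU1 card_imset //; case: imsetP => // -[t _ E].
  by move: (pu t); rewrite E eqxx.
apply: subset_leq_card; apply/subsetP => X; rewrite in_setU1 => /orP[/eqP ->|/imsetP[t _ ->]].
  by rewrite in_line_points dim_vline u0 -memvE ul.
by rewrite in_line_points dim_vline p0 -memvE memvD // rpredZ.
Qed.

Lemma secantP (K : {set pg F}) P Q m : \dim m = 2 -> \dim P = 1 -> \dim Q = 1 -> P <> Q ->
  P \in K -> Q \in K -> (P <= m)%VS -> (Q <= m)%VS -> secant m K.
Proof.
move=> dm dP dQ /eqP nPQ PK QK Pm Qm; rewrite /secant inE dm eqxx.
have: [set P; Q] \subset K :&: line_points m.
  by apply/subsetP => X /set2P[] ->; rewrite in_setI in_line_points ?PK ?QK ?dP ?dQ ?Pm ?Qm.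
by move/subset_leq_card; rewrite cards2 nPQ.
Qed.

Lemma tangentP (K : {set pg F}) P m : \dim m = 2 -> \dim P = 1 ->
  P \in K -> (P <= m)%VS -> (forall X, X \in K -> \dim X = 1 -> (X <= m)%VS -> X = P) ->
  tangent m K.
Proof.
move=> dm dP PK Pm H; rewrite /tangent inE dm eqxx; apply/cards1P; exists P.
apply/setP => X; rewrite in_setI in_line_points in_set1; apply/and3P/eqP => [[XK /eqP dX Xm]|->].
  exact: H.
by rewrite PK dP Pm.
Qed.

(** * Characteristic 2 and the Fano configuration *)

Lemma even_card_pchar2 : ~~ odd #|F| -> 2 \in [pchar F]%R.
Proof.
rewrite -dvdn2 -cardsT => ev.
(* Cauchy's theorem in the additive group of F: some x <> 0 satisfies 2x = 0, which forces 2 = 0 in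
   F. *)
have [x _ ox] := Cauchy (p := 2) isT ev.
have x0 : x != 0%R by apply: contra_eq_neq ox => ->; rewrite -zmod1gE order1.
have := expg_order x; rewrite ox zmodXgE zmod1gE => /eqP.
by rewrite -mulr_natr mulf_eq0 (negbTE x0) inE.
Qed.

(* The right-hand side joins two diagonal points of the quadrangle A, B, C, D,
   and A1 is the third: in characteristic 2 the diagonal points are collinear. *)
Lemma fano (A B C D A1 : pg F) : 2 \in [pchar F]%R ->
  \dim A = 1 -> \dim D = 1 -> \dim A1 = 1 -> D <> A -> D <> A1 ->
  (D <= A + A1)%VS -> (A1 <= B + C)%VS ->
  (A1 <= ((B + D) :&: (A + C)) + ((C + D) :&: (A + B)))%VS.
Proof.
move=> ch2 dA dD dA1 nDA nDA1 DA /subvP A1BC.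
have /memv_addP[u uA [w wA1 dE]] := subvP DA _ (memv_pick D).
have /memv_addP[v vB [t tC wE]] := A1BC _ wA1.
have d0 : (vpick D != 0)%R by rewrite vpick0 -dimv_eq0 dD.
have dDm := memv_pick D.
have u0 : (u != 0)%R.
  apply/eqP => u0; apply: nDA1; rewrite u0 add0r in dE.
  by rewrite (point_vline A1 _ dA1 _ d0) ?dE // -dE; apply: point_vline.
have w0 : (w != 0)%R.
  apply/eqP => w0; apply: nDA; rewrite w0 addr0 in dE.
  by rewrite (point_vline A _ dA _ d0) ?dE // -dE; apply: point_vline.
rewrite (point_vline A1 w dA1 wA1 w0) -memvE.
have addK2 x y : (x + (x + y) = y :> 'rV[F]_3)%R.
  by rewrite -{1}[x]scale1r -(oppr_pchar2 ch2 1%R) scaleN1r addKr.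
(* With d = u + w and w = v + t, characteristic 2 gives u + t = v + d, in both AC and BD, and u + v
   = t + d, in both AB and CD. So w is a sum of vectors from the two diagonal points. *)
have -> : w = (u + t + (u + v))%R.
  by rewrite wE addrACA -addrA addK2 addrC.
apply: memv_add; rewrite memv_cap; apply/andP; split.
- have -> : (u + t = v + vpick D)%R.
    by rewrite dE wE [RHS]addrCA addK2.
  exact: memv_add.
- exact: memv_add.
- have -> : (u + v = t + vpick D)%R.
    by rewrite dE wE [RHS]addrCA [(v + t)%R]addrC addK2.
  exact: memv_add.
- exact: memv_add.
Qed.

End Plane.

(** * The triangle, the line [l] and the points D_i, B_i, C_i *)

Section Configuration.
Context {F : finFieldType}.
Implicit Types (P X a b c l m : pg F) (D : nat -> pg F).

Set Implicit Arguments.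
(** The incidence data of a k-construction without the choice of D_2, which treats [b] and [c]
    differently: this makes the record symmetric in [b] and [c]. *)
Record configuration a b c l n D : Prop := Configuration {
  cfg_a : \dim a = 2;
  cfg_b : \dim b = 2;
  cfg_c : \dim c = 2;
  cfg_l : \dim l = 2;
  cfg_ab : a <> b;
  cfg_ac : a <> c;
  cfg_bc : b <> c;
  cfg_triangle : forall X, \dim X = 1 ->
    (X <= a)%VS -> (X <= b)%VS -> (X <= c)%VS -> False;
  cfg_lA : (b :&: c <= l)%VS;
  cfg_lb : l <> b;
  cfg_lc : l <> c;
  cfg_D : forall i : 'I_n, [/\ \dim (D i.+1) = 1, (D i.+1 <= l)%VS,
    D i.+1 <> (b :&: c)%VS & D i.+1 <> (l :&: a)%VS]
}.
Unset Implicit Arguments.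

(** Exchanging [b] and [c] exchanges B with C and, by conversion, [kB] with [kC]. Hence each fact
    about the B_i also serves for the C_i. *)
Lemma configuration_sym {a b c l n D} :
  configuration a b c l n D -> configuration a c b l n D.
Proof.
case=> da db dc dl nab nac nbc tri lA lb lc hD; split; rewrite ?[(c :&: b)%VS]capvC //.
- by move=> E; apply: nbc.
- by move=> X dX Xa Xc Xb; apply: (tri X).
Qed.

Lemma k_construction_set_sym a b c n D :
  k_construction_set a b c n D = k_construction_set a c b n D.
Proof.
rewrite /k_construction_set [X in _ :\: X]setUC; congr ((_ :|: _) :\: _).
by apply/setP => X; rewrite !inE addnAC.
Qed.

Lemma configurationP {k n a b c l D} {K : {set pg F}} :
  k_construction k a b c l n D K -> configuration a b c l n D.
Proof.
case=> _ [/[!inE] /eqP da /eqP db /eqP dc] nconc /eqP dl lA [/eqP lb /eqP lc] _ hD _ _ _ _.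
have tri X : \dim X = 1 -> (X <= a)%VS -> (X <= b)%VS -> (X <= c)%VS -> False.
  by move=> dX Xa Xb Xc; apply: nconc; exists X; rewrite ?inE ?dX ?Xa ?Xb.
(* If two of the sides coincided, a common point with the third would lie on all three. *)
have neq l1 l2 l3 : \dim l1 = 2 -> \dim l3 = 2 ->
    (forall X, \dim X = 1 -> (X <= l1)%VS -> (X <= l2)%VS -> (X <= l3)%VS -> False) ->
    l1 <> l2.
  move=> d1 d3 H E; subst l2; case: (l1 =P l3) => [E|n13].
    subst l3; apply: (H <[vpick l1]>%VS); rewrite -?memvE ?memv_pick //.
    by rewrite dim_vline vpick0 -dimv_eq0 d1.
  by apply: (H (l1 :&: l3)%VS); rewrite ?dim_meet ?capvSl ?capvSr.
split=> //; [exact: (neq a b c)|apply: (neq a c b)|apply: (neq b c a)|] => //.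
- by move=> X dX Xa Xc Xb; apply: (tri X).
- by move=> X dX Xb Xc Xa; apply: (tri X).
move=> i; have := hD i.+1 (ltn_ord i).
by rewrite !inE negb_or => /and3P[/andP[/eqP nA /eqP nA'] /eqP dD Dl].
Qed.

Section Fixed.
Context {a b c l : pg F} {n : nat} {D : nat -> pg F}.
Context (cfg : configuration a b c l n D).
Let da := cfg_a cfg.
Let db := cfg_b cfg.
Let dc := cfg_c cfg.
Let dl := cfg_l cfg.
Let nab := cfg_ab cfg.
Let nac := cfg_ac cfg.
Let nbc := cfg_bc cfg.
Let tri := cfg_triangle cfg.
Let A := (b :&: c)%VS.
Let B := (a :&: c)%VS.
Let C := (a :&: b)%VS.
Let K := k_construction_set a b c n D.

Lemma dim_B : \dim B = 1.
Proof. exact: dim_meet. Qed.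

Lemma dim_A : \dim A = 1.
Proof. exact: dim_meet. Qed.

Lemma A_notin_a : ~ (A <= a)%VS.
Proof. by move=> H; apply: (tri A); rewrite ?dim_A ?capvSl ?capvSr. Qed.

Lemma B_notin_b : ~ (B <= b)%VS.
Proof. by move=> H; apply: (tri B); rewrite ?dim_B ?capvSl ?capvSr. Qed.

Lemma neq_la : l <> a.
Proof. by move=> E; apply: A_notin_a; rewrite -E (cfg_lA cfg). Qed.

Lemma eq_A X : \dim X = 1 -> (X <= l)%VS -> (X <= b)%VS -> X = A.
Proof.
move=> dX Xl Xb; rewrite -(meet_eq X l b) ?(meet_eq A l b) //.
- exact: dim_A.
- exact: (cfg_lb cfg).
- exact: (cfg_lA cfg).
- exact: capvSl.
- exact: (cfg_lb cfg).
Qed.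

(** Otherwise [l] would join A and B, and so be [c]. Consequently BD_i is a proper line. *)
Lemma B_notin_l : ~ (B <= l)%VS.
Proof.
move=> Bl; have nBA : B <> A by move=> E; apply: B_notin_b; rewrite E capvSl.
apply: (cfg_lc cfg); apply: (lines_eq B A) => //; rewrite ?dim_A ?dim_B ?capvSr //.
exact: (cfg_lA cfg).
Qed.

Lemma neq_BD (i : 'I_n) : B <> D i.+1.
Proof. by case: (cfg_D cfg i) => _ Dl _ _ E; apply: B_notin_l; rewrite E. Qed.

Lemma dim_BD (i : 'I_n) : \dim (B + D i.+1) = 2.
Proof.
by apply: dim_join; [exact: dim_B|case: (cfg_D cfg i)|exact: neq_BD].
Qed.

Lemma neq_BDb (i : 'I_n) : (B + D i.+1)%VS <> b.
Proof. by move=> E; apply: B_notin_b; rewrite -E addvSl. Qed.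

Lemma dim_kB (i : 'I_n) : \dim (kB a b c D i.+1) = 1.
Proof. by apply: dim_meet; rewrite ?dim_BD //; apply: neq_BDb. Qed.

Lemma kB_in_b (i : 'I_n) : (kB a b c D i.+1 <= b)%VS.
Proof. exact: capvSr. Qed.

Lemma kB_in_BD (i : 'I_n) : (kB a b c D i.+1 <= B + D i.+1)%VS.
Proof. exact: capvSl. Qed.

(** A line through B and B_i is BD_i, so it contains D_i. Applied to [a] and to [c], this keeps B_i
    off both. *)
Lemma kB_notin (i : 'I_n) m : \dim m = 2 -> (B <= m)%VS ->
  ~ (D i.+1 <= m)%VS -> ~ (kB a b c D i.+1 <= m)%VS.
Proof.
move=> dm Bm nDm km; apply: nDm.
rewrite (_ : m = (B + D i.+1)%VS) ?addvSr //.
apply: (lines_eq B (kB a b c D i.+1)); rewrite ?dim_B ?dim_kB ?dim_BD ?addvSl ?kB_in_BD //.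
by move=> E; apply: B_notin_b; rewrite E kB_in_b.
Qed.

Lemma D_notin_a (i : 'I_n) : ~ (D i.+1 <= a)%VS.
Proof.
case: (cfg_D cfg i) => dD Dl _ nA' Da; apply: nA'.
by apply/esym/meet_eq => //; apply: neq_la.
Qed.

Lemma D_notin_b (i : 'I_n) : ~ (D i.+1 <= b)%VS.
Proof. by case: (cfg_D cfg i) => dD Dl nA _ /(eq_A _ dD Dl). Qed.

Lemma kB_notin_a (i : 'I_n) : ~ (kB a b c D i.+1 <= a)%VS.
Proof. by apply: kB_notin; rewrite ?capvSl //; apply: D_notin_a. Qed.

(** Used for tangents, where every point of K on the line has to be identified. *)
Lemma mem_KP X : X \in K -> [/\ \dim X = 1,
  forall i : 'I_n, X <> kB a b c D i.+1,
  forall i : 'I_n, X <> kC a b c D i.+1 &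
  [\/ [/\ (X <= a)%VS, ~ (X <= b)%VS & ~ (X <= c)%VS],
      [/\ ~ (X <= a)%VS, (X <= b)%VS & ~ (X <= c)%VS],
      [/\ ~ (X <= a)%VS, ~ (X <= b)%VS & (X <= c)%VS]
    | exists i : 'I_n, X = D i.+1]].
Proof.
rewrite in_setD !in_setU negb_or => /andP[/andP[nB nC] XTD].
have dX : \dim X = 1.
  case/orP: XTD => [|/imsetP[i _ ->]]; last by case: (cfg_D cfg i).
  by rewrite !inE => /andP[/eqP].
split=> // [i E|i E|].
- by case/negP: nB; apply/imsetP; exists i.
- by case/negP: nC; apply/imsetP; exists i.
case/orP: XTD => [|/imsetP[i _ ->]]; last by constructor 4; exists i.
rewrite !inE => /andP[_].
case Xa: (X <= a)%VS; case Xb: (X <= b)%VS; case Xc: (X <= c)%VS => // _.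
- by constructor 1.
- by constructor 2.
- by constructor 3.
Qed.

(** The C_i lie on [c], so only the B_i can be removed here. *)
Lemma K_b X : \dim X = 1 -> (X <= b)%VS -> ~ (X <= a)%VS -> ~ (X <= c)%VS ->
  (forall i : 'I_n, X <> kB a b c D i.+1) -> X \in K.
Proof.
move=> dX Xb /negP Xa /negP Xc nB; rewrite in_setD !in_setU negb_or -andbA.
apply/and3P; split.
- by apply/imsetP => -[i _]; apply: nB.
- by apply: contra Xc => /imsetP[i _ ->]; apply: capvSr.
by rewrite !inE dX Xb (negbTE Xa) (negbTE Xc).
Qed.

End Fixed.

(** At least q + 1 points, at most q - 1 of them missing from K, leave two. *)
Lemma secant_card (K s : {set pg F}) m :
  \dim m = 2 -> #|s| < #|F| -> line_points m :\: s \subset K ->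
  secant m K.
Proof.
move=> dm sF sub; rewrite /secant inE dm eqxx /=.
have : line_points m :\: s \subset K :&: line_points m by rewrite subsetI sub subsetDl.
move/subset_leq_card; apply: leq_trans; rewrite cardsD ltn_subRL addn1.
apply: leq_ltn_trans (card_line_points m dm); apply: leq_ltn_trans sF.
exact/subset_leq_card/subsetIr.
Qed.

Lemma kB_notin_c {a b c l n D} : configuration a b c l n D ->
  forall i : 'I_n, ~ (kB a b c D i.+1 <= c)%VS.
Proof.
move=> cfg i; apply: (kB_notin cfg); rewrite ?(cfg_c cfg) ?capvSr //.
exact: D_notin_b (configuration_sym cfg) i.
Qed.

(** All removed points lie on [b] or [c], so [a] loses only its vertices. *)
Lemma K_a {a b c n D} X :
  \dim X = 1 -> (X <= a)%VS -> ~ (X <= b)%VS -> ~ (X <= c)%VS ->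
  X \in k_construction_set a b c n D.
Proof.
move=> dX Xa /negP Xb /negP Xc; rewrite in_setD !in_setU negb_or -andbA.
apply/and3P; split.
- by apply: contra Xb => /imsetP[i _ ->]; apply: capvSr.
- by apply: contra Xc => /imsetP[i _ ->]; apply: capvSr.
by rewrite !inE dX Xa (negbTE Xb) (negbTE Xc).
Qed.

(** * Points of K on [b] *)

Lemma r_infty_on_b {a b c l n D P} : configuration a b c l n D ->
  n + 3 <= #|F| -> P \in k_construction_set a b c n D -> (P <= b)%VS ->
  r_infty_property (k_construction_set a b c n D) P.
Proof.
move=> cfg n3 PK Pb; have [dP PnB PnC Pcase] := mem_KP cfg P PK.
have [nPa nPc] : ~ (P <= a)%VS /\ ~ (P <= c)%VS.
  case: Pcase => [[]|[]|[]|[i E]] //.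
  by case: (D_notin_b cfg i); rewrite -E.
have [da db dc dl] := And4 (cfg_a cfg) (cfg_b cfg) (cfg_c cfg) (cfg_l cfg).
have nab := cfg_ab cfg; have nac := cfg_ac cfg; have nbc := cfg_bc cfg.
set B := (a :&: c)%VS; set C := (a :&: b)%VS.
have dB : \dim B = 1 := dim_B cfg.
have dC : \dim C = 1 by apply: dim_meet.
have Ba : (B <= a)%VS by apply: capvSl.
have Bc : (B <= c)%VS by apply: capvSr.
have nBP : B <> P by move=> E; apply: nPa; rewrite -E.
have dt := dim_join B P dB dP nBP.
split=> //; exists (B + P)%VS; split; first exact: addvSr.
  apply: (tangentP _ P) => //; first exact: addvSr.
  move=> X XK dX Xt.
  (* Any line through B other than BP meets BP in B only; this is applied to [a] and [c]. *)
  have notBX m : \dim m = 2 -> (B <= m)%VS -> ~ (P <= m)%VS -> (X <= m)%VS -> X = B.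
    move=> dm Bm nPm Xm; case: (X =P B) => // nXB; case: nPm.
    by rewrite (lines_eq X B m (B + P)%VS) ?addvSl ?addvSr.
  have [_ _ _ [[Xa Xb Xc]|[Xa Xb Xc]|[Xa Xb Xc]|[i XD]]] := mem_KP cfg X XK.
  - by case: Xc; rewrite (notBX a).
  - case: (X =P P) => // nXP; case: (B_notin_b cfg).
    by rewrite -/B (lines_eq X P b (B + P)%VS) ?addvSl ?addvSr.
  - by case: Xa; rewrite (notBX c).
  (* If D_i were on BP, then BD_i = BP would meet [b] in P, making P the removed point B_i. *)
  case: (PnB i); rewrite /kB -/B -XD; apply/esym.
  have nBX : B <> X by rewrite XD; apply: neq_BD cfg i.
  have E : (B + X)%VS = (B + P)%VS.
    by apply: (lines_eq B X); rewrite ?dim_join ?addvSl ?addvSr.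
  apply: meet_eq; rewrite ?E ?addvSr // => Eb.
  by apply: (B_notin_b cfg); rewrite -/B -Eb addvSl.
move=> m; rewrite inE => /eqP dm Pm /eqP nmt.
case: (m =P b) => [->|nmb].
  (* The points of [b] outside K are among A, C and the B_i, at most n + 2 < q in number. *)
  apply: (secant_card _
    ([set (b :&: c)%VS; C] :|: [set kB a b c D i.+1 | i : 'I_n])) => //.
    apply: leq_trans n3; rewrite (addnC n 3) ltnS.
    apply: leq_trans (leq_card_setU _ _) _; rewrite -(add2n n) leq_add //.
      by rewrite cards2; case: eqP.
    by rewrite (leq_trans (leq_imset_card _ _)) ?card_ord.
  apply/subsetP => X; rewrite in_setD in_setU in_set2 in_line_points !negb_or.
  case/andP=> /andP[/andP[/eqP nA /eqP nC] nB] /andP[/eqP dX Xb].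
  apply: K_b => //.
  - by move=> Xa; apply: nC; apply/esym/meet_eq.
  - by move=> Xc; apply: nA; apply/esym/meet_eq.
  - by move=> i E; case/imsetP: nB; exists i.
have nma : m <> a by move=> E; apply: nPa; rewrite -E.
have dX := dim_meet m a dm da nma.
have Xm : (m :&: a <= m)%VS by apply: capvSl.
have Xa : (m :&: a <= a)%VS by apply: capvSr.
apply: (secantP _ P (m :&: a)%VS) => //; first by move=> E; apply: nPa; rewrite E.
(* The meet of m and [a] is not a vertex: on [b] it would give m = [b], and on [c] it would be B, so
   that m is the tangent BP. *)
apply: K_a => // [Xb|Xc].
  apply: nmb; apply: (lines_eq P (m :&: a)%VS) => //.
  by move=> E; apply: nPa; rewrite E.
apply: nmt; rewrite (_ : B = m :&: a)%VS.
  by apply/esym/join_eq => // E; apply: nPa; rewrite -E.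
exact: meet_eq.
Qed.

(** * Points of K on [a] *)

Lemma r_infty_on_a {a b c l n D P} : configuration a b c l n D ->
  3 < #|F| -> P \in k_construction_set a b c n D -> (P <= a)%VS ->
  P <> (l :&: a)%VS ->
  (forall i j : 'I_n, P <> ((kB a b c D i.+1 + kC a b c D j.+1) :&: a)%VS) ->
  r_infty_property (k_construction_set a b c n D) P.
Proof.
move=> cfg F3 PK Pa nPA' nPBC; have [dP PnB PnC Pcase] := mem_KP cfg P PK.
have [nPb nPc] : ~ (P <= b)%VS /\ ~ (P <= c)%VS.
  case: Pcase => [[]|[]|[]|[i E]] //.
  by case: (D_notin_a cfg i); rewrite -E.
have [da db dc dl] := And4 (cfg_a cfg) (cfg_b cfg) (cfg_c cfg) (cfg_l cfg).
have nab := cfg_ab cfg; have nac := cfg_ac cfg; have nbc := cfg_bc cfg.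
set A := (b :&: c)%VS.
have dA : \dim A = 1 by apply: dim_meet.
have Ab : (A <= b)%VS by apply: capvSl.
have Ac : (A <= c)%VS by apply: capvSr.
have Al : (A <= l)%VS := cfg_lA cfg.
have nPl : ~ (P <= l)%VS.
  by move=> Pl; apply: nPA'; apply/esym/meet_eq => //; apply: neq_la cfg.
have nAP : A <> P by move=> E; apply: nPb; rewrite -E.
have dt := dim_join A P dA dP nAP.
split=> //; exists (A + P)%VS; split; first exact: addvSr.
  apply: (tangentP _ P) => //; first exact: addvSr.
  move=> X XK dX Xt.
  (* Applied to [b], [c] and also [l]: as P is not on [l], the line AP contains no D_i. *)
  have notAX m : \dim m = 2 -> (A <= m)%VS -> ~ (P <= m)%VS -> (X <= m)%VS -> X = A.
    move=> dm Am nPm Xm; case: (X =P A) => // nXA; case: nPm.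
    by rewrite (lines_eq X A m (A + P)%VS) ?addvSl ?addvSr.
  have [_ _ _ [[Xa Xb Xc]|[Xa Xb Xc]|[Xa Xb Xc]|[i XD]]] := mem_KP cfg X XK.
  - case: (X =P P) => // nXP; case: (A_notin_a cfg).
    by rewrite -/A (lines_eq X P a (A + P)%VS) ?addvSl ?addvSr.
  - by case: Xc; rewrite (notAX b).
  - by case: Xb; rewrite (notAX c).
  case: (cfg_D cfg i) => _ Dl nDA _; case: nDA.
  by rewrite -XD; apply: (notAX l) => //; rewrite XD.
move=> m; rewrite inE => /eqP dm Pm /eqP nmt.
case: (m =P a) => [->|nma].
  apply: (secant_card _ [set (a :&: b)%VS; (a :&: c)%VS]) => //.
    by apply: leq_ltn_trans F3; rewrite cards2; case: eqP.
  apply/subsetP => X; rewrite in_setD in_set2 in_line_points !negb_or.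
  case/andP=> /andP[/eqP nC /eqP nB] /andP[/eqP dX Xa].
  apply: K_a => //.
  - by move=> Xb; apply: nC; apply/esym/meet_eq.
  - by move=> Xc; apply: nB; apply/esym/meet_eq.
have nmA : ~ (A <= m)%VS.
  by move=> Am; apply: nmt; apply/esym/join_eq.
have nmb : m <> b by move=> E; apply: nPb; rewrite -E.
have nmc : m <> c by move=> E; apply: nPc; rewrite -E.
have meet_m d : \dim d = 2 -> d <> a -> m <> d -> ~ (P <= d)%VS ->
    [/\ \dim (m :&: d) = 1, P <> (m :&: d)%VS & ~ (m :&: d <= a)%VS].
  move=> dd nda nmd nPd; have dX := dim_meet m d dm dd nmd.
  have nPX : P <> (m :&: d)%VS by move=> E; apply: nPd; rewrite E capvSr.
  split=> // Xa; apply: nma; apply: (lines_eq P (m :&: d)%VS) => //.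
  exact: capvSl.
have [dX nPX nXa] := meet_m b db (nesym nab) nmb nPb.
have [dY nPY nYa] := meet_m c dc (nesym nac) nmc nPc.
have nXc : ~ (m :&: b <= c)%VS.
  by move=> Xc; apply: nmA; rewrite /A (meet_eq (m :&: b)%VS) ?capvSl ?capvSr.
have nYb : ~ (m :&: c <= b)%VS.
  by move=> Yb; apply: nmA; rewrite /A (meet_eq (m :&: c)%VS) ?capvSl ?capvSr.
have secK X : \dim X = 1 -> (X <= m)%VS -> P <> X ->
    X \in k_construction_set a b c n D -> secant m (k_construction_set a b c n D).
  by move=> *; apply: (secantP _ P X).
case: (boolP ((m :&: b)%VS \in k_construction_set a b c n D)) => [|/negP XK].
  by apply: secK => //; apply: capvSl.
case: (boolP ((m :&: c)%VS \in k_construction_set a b c n D)) => [|/negP YK].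
  by apply: secK => //; apply: capvSl.
(* A point of [b] off [a] and [c] is missing from K only if it is some B_i; likewise for [c] and the
   C_j. *)
have [i Xi] : exists i : 'I_n, (m :&: b)%VS = kB a b c D i.+1.
  case: (pickP [pred i : 'I_n | (m :&: b)%VS == kB a b c D i.+1]) => [i /eqP|] H.
    by exists i.
  by case: XK; apply: K_b => //; rewrite ?capvSr // => i /eqP; rewrite [_ == _]H.
have [j Yj] : exists j : 'I_n, (m :&: c)%VS = kC a b c D j.+1.
  case: (pickP [pred j : 'I_n | (m :&: c)%VS == kC a b c D j.+1]) => [j /eqP|] H.
    by exists j.
  case: YK; rewrite k_construction_set_sym.
  by apply: K_b => //; rewrite ?capvSr // => i' /eqP; rewrite [_ == _]H.
(* Now m is B_iC_j, so P is its meet with [a], which is excluded. *)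
case: (nPBC i j); rewrite -Xi -Yj (join_eq _ _ m) ?capvSl //.
  by apply/esym/meet_eq.
by move=> E; apply: nXc; rewrite E capvSr.
Qed.

(** * The point A' lies on some line B_iC_j *)

Lemma l_meet_a_odd {a b c l n D} (i j : 'I_n) : configuration a b c l n D ->
  D j.+1 = (((a :&: b) + (((l :&: a) + kB a b c D i.+1) :&: c)) :&: l)%VS ->
  (l :&: a)%VS = ((kB a b c D i.+1 + kC a b c D j.+1) :&: a)%VS.
Proof.
move=> cfg; set A' := (l :&: a)%VS; set B1 := kB a b c D i.+1.
set C2 := (_ :&: c)%VS; set C := (a :&: b)%VS => Dj.
have cfg' := configuration_sym cfg.
have [da db dc dl] := And4 (cfg_a cfg) (cfg_b cfg) (cfg_c cfg) (cfg_l cfg).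
have dA' : \dim A' = 1 by apply: dim_meet => //; apply: neq_la cfg.
have dB1 : \dim B1 = 1 := dim_kB cfg i.
have dC : \dim C = 1 := dim_B cfg'.
have nB1a : ~ (B1 <= a)%VS := kB_notin_a cfg i.
have nB1c : ~ (B1 <= c)%VS := kB_notin_c cfg i.
have nA'B1 : A' <> B1 by move=> E; apply: nB1a; rewrite -E capvSr.
have dA'B1 := dim_join A' B1 dA' dB1 nA'B1.
have dC2 : \dim C2 = 1.
  by apply: dim_meet => // E; apply: nB1c; rewrite -E addvSr.
have nCc : ~ (C <= c)%VS := B_notin_b cfg'.
have nCC2 : C <> C2 by move=> E; apply: nCc; rewrite E capvSr.
have nCD : C <> D j.+1 := neq_BD cfg' j.
have [dD _ _ _] := cfg_D cfg j.
(* D_j is on CC_2, so CD_j = CC_2 meets [c] in C_2. Hence C_j = C_2, which lies on A'B_i by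
   construction. *)
have CD : (C + D j.+1)%VS = (C + C2)%VS.
  by apply: join_eq; rewrite ?dim_join ?addvSl // Dj capvSl.
have kC2 : kC a b c D j.+1 = C2.
  apply: meet_eq; rewrite -/C ?CD ?dim_join ?addvSr ?capvSr // => E.
  by apply: nCc; rewrite -E addvSl.
have nB1C2 : B1 <> C2 by move=> E; apply: nB1c; rewrite E capvSr.
rewrite kC2 (join_eq B1 C2 (A' + B1)%VS) ?addvSr ?capvSl //.
apply/esym/meet_eq; rewrite ?addvSl ?capvSr // => E.
by apply: nB1a; rewrite -E addvSr.
Qed.

(** In the quadrangle A, B, C, D_i the diagonal points are A' (as AD_i = [l]), B_i and C_i, so
    [fano] makes them collinear. *)
Lemma l_meet_a_even {a b c l n D} (i : 'I_n) : configuration a b c l n D ->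
  ~~ odd #|F| ->
  (l :&: a)%VS = ((kB a b c D i.+1 + kC a b c D i.+1) :&: a)%VS.
Proof.
move=> cfg /even_card_pchar2 ch2; have cfg' := configuration_sym cfg.
have [da db dc dl] := And4 (cfg_a cfg) (cfg_b cfg) (cfg_c cfg) (cfg_l cfg).
have nab := cfg_ab cfg; have nac := cfg_ac cfg; have nbc := cfg_bc cfg.
set A := (b :&: c)%VS; set B := (a :&: c)%VS; set C := (a :&: b)%VS.
set A' := (l :&: a)%VS.
have dA' : \dim A' = 1 by apply: dim_meet => //; apply: neq_la cfg.
have dA : \dim A = 1 := dim_A cfg.
have dB : \dim B = 1 := dim_B cfg.
have dC : \dim C = 1 := dim_B cfg'.
have dB1 := dim_kB cfg i.
have dC1 : \dim (kC a b c D i.+1) = 1 := dim_kB cfg' i.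
have nAa : ~ (A <= a)%VS := A_notin_a cfg.
have nBb : ~ (B <= b)%VS := B_notin_b cfg.
have nAB : A <> B by move=> E; apply: nBb; rewrite -E capvSl.
have nAC : A <> C by move=> E; apply: nAa; rewrite E capvSl.
have nBC : B <> C by move=> E; apply: nBb; rewrite E capvSr.
have nAA' : A <> A' by move=> E; apply: nAa; rewrite E capvSr.
have [dD Dl nDA nDA'] := cfg_D cfg i.
have nB1a : ~ (kB a b c D i.+1 <= a)%VS := kB_notin_a cfg i.
have nB1c : ~ (kB a b c D i.+1 <= c)%VS := kB_notin_c cfg i.
have nB1C1 : kB a b c D i.+1 <> kC a b c D i.+1.
  by move=> E; apply: nB1c; rewrite E capvSr.
apply/esym/meet_eq; rewrite ?dim_join ?capvSr //.
  by move=> E; apply: nB1a; rewrite -[X in (_ <= X)%VS]E addvSl.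
have AB : (A + B)%VS = c by apply: join_eq; rewrite ?capvSr.
have AC : (A + C)%VS = b by apply: join_eq; rewrite ?capvSl ?capvSr.
have BC : (B + C)%VS = a by apply: join_eq; rewrite ?capvSl.
have DA : (D i.+1 <= A + A')%VS by rewrite (join_eq A A' l) ?capvSl // (cfg_lA cfg).
have A'BC : (A' <= B + C)%VS by rewrite BC capvSr.
have := fano A B C (D i.+1) A' ch2 dA dD dA' nDA nDA' DA A'BC.
by rewrite AB AC.
Qed.

End Configuration.

Theorem theorem3p11 (q : nat) (F : finFieldType) (hq : 5 <= q)
    (hF : #|F| = q) (k n : nat) (a b c l : {vspace 'rV[F]_3})
    (D : nat -> {vspace 'rV[F]_3}) (K : {set {vspace 'rV[F]_3}})
    (hmin : minimal_blocking_set K)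
    (hK : k_construction k a b c l n D K)
    (hk : 2 * q <= k <= 3 * q - 5)
    (P : {vspace 'rV[F]_3})
    (hP : P \in K :&:
      ((line_points a :\:
          [set ((kB a b c D i.+1 + kC a b c D j.+1) :&: a)%VS
            | i : 'I_n, j : 'I_n])
       :|: line_points b :|: line_points c)) :
  r_infty_property K P.
Proof.
have cfg := configurationP hK.
case: hK => _ _ _ _ _ _ /andP[n2 _] _ _ D2 KE kE.
rewrite KE in hP *; move: hk => /andP[hk _].
(* From 2q <= k = 3q - 3 - n. *)
have n3 : n + 3 <= #|F| by lia.
move: hP; rewrite in_setI => /andP[PK].
rewrite !in_setU in_setD !in_line_points -orbA => /or3P[/andP[nBC]||] /andP[/eqP dP Pm].
- have {}nBC (i j : 'I_n) :
      P <> ((kB a b c D i.+1 + kC a b c D j.+1) :&: a)%VS.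
    by move=> E; case/imset2P: nBC; exists i j.
  apply: (r_infty_on_a cfg) => //; first by lia.
  (* It remains to rule out P = A'. Since n >= 2, [ord0] and [lift ord0 ord0] exist in ['I_n]; they
     stand for the indices 1 and 2. *)
  case: n n2 D2 nBC cfg {PK KE kE n3} => [|[|n']] // _ D2 nBC cfg E.
  case: (boolP (odd #|F|)) => [/D2|] hq2.
    by apply: (nBC ord0 (lift ord0 ord0)); rewrite E; apply: l_meet_a_odd cfg _.
  by apply: (nBC ord0 ord0); rewrite E; apply: l_meet_a_even cfg _.
- exact: (r_infty_on_b cfg).
(* For P on [c], exchange [b] and [c]. *)
rewrite k_construction_set_sym; apply: (r_infty_on_b (configuration_sym cfg)) => //.
by rewrite -k_construction_set_sym.
Qed.
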